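(* Let $\lambda\in\mathbb{R}$, let $Y$ be a random variable whose moment generating function exists in a neighborhood of the origin, and let $x\in[0,1]$. For all integers $n\ge k\ge 0$, \[ B_{k,n}^{Y}(x|\lambda)=\sum_{j=0}^{n-k}\binom{n}{k}(x)_{k,\lambda}\binom{1-x}{j}j!\,{n-k \brace j}_{Y,\lambda}. \]
   Context: For $\lambda\in\mathbb{R}$, the degenerate falling factorial is $(x)_{0,\lambda}=1$, $(x)_{n,\lambda}=x(x-\lambda)(x-2\lambda)\cdots(x-(n-1)\lambda)$ for $n\ge1$, and the degenerate exponential is $e_\lambda^x(t)=\sum_{n\ge0}(x)_{n,\lambda}\frac{t^n}{n!}$ (for $\lambda\neq0$ this is $(1+\lambda t)^{x/\lambda}$). For the random variable $Y$ (all of whose moments exist), $E[e_\lambda^Y(t)]$ denotes $\sum_{n\ge0}E[(Y)_{n,\lambda}]\frac{t^n}{n!}$; it has constant term $1$, and for real $a$ the power $(E[e_\lambda^Y(t)])^a$ means $\sum_{j\ge0}\binom{a}{j}(E[e_\lambda^Y(t)]-1)^j$, with $\binom{a}{j}=a(a-1)\cdots(a-j+1)/j!$. The probabilistic degenerate Stirling numbers of the second kind associated with $Y$ are defined by $\frac{1}{k!}(E[e_\lambda^Y(t)]-1)^k=\sum_{n\ge k}{n\brace k}_{Y,\lambda}\frac{t^n}{n!}$. The probabilistic degenerate Bernstein polynomials associated with $Y$ are defined by \[\frac{1}{k!}(x)_{k,\lambda}t^k\big(E[e_\lambda^Y(t)]\big)^{1-x}=\sum_{n\ge k}B_{k,n}^{Y}(x|\lambda)\frac{t^n}{n!},\quad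 k\ge0.\] *)

(* Defs.v *)
From HB Require Import structures.
From mathcomp Require Import all_boot all_order all_algebra.
From mathcomp Require Import all_classical all_reals all_analysis.

Set Implicit Arguments.
Unset Strict Implicit.
Unset Printing Implicit Defensive.

Import Order.TTheory GRing.Theory Num.Theory.
Import numFieldNormedType.Exports.

Local Open Scope classical_set_scope.
Local Open Scope ring_scope.

Definition degenerate_falling (R : realType) (lambda x : R) (n : nat) : R :=
  \prod_(i < n) (x - i%:R * lambda).

Definition gbinom (R : realType) (a : R) (j : nat) : R :=
  (\prod_(i < j) (a - i%:R)) / j`!%:R.

(* A formal power series is the sequence of its coefficients: [f n] is the
   coefficient of t^n.  The pointwise ring structure that functions into [R]
   inherit is not the one wanted, whence the explicit operations below. *)
Definition fps (R : realType) : Type := nat -> R.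

Definition fps_one (R : realType) : fps R := fun n => (n == 0%N)%:R.

Definition fps_Xn (R : realType) (k : nat) : fps R := fun n => (n == k)%:R.

Definition fps_sub (R : realType) (f g : fps R) : fps R := fun n => f n - g n.

Definition fps_scale (R : realType) (c : R) (f : fps R) : fps R :=
  fun n => c * f n.

Definition fps_mul (R : realType) (f g : fps R) : fps R :=
  fun n => \sum_(i < n.+1) f i * g (n - i)%N.

Definition fps_exp (R : realType) (f : fps R) (k : nat) : fps R :=
  iter k (fps_mul f) (fps_one R).

(* sum_(n >= k) a_n t^n / n! *)
Definition egf_from (R : realType) (k : nat) (a : nat -> R) : fps R :=
  fun n => if (k <= n)%N then a n / n`!%:R else 0.

(* f^a = sum_(j >= 0) binom(a, j) (f - 1)^j for a real exponent a, summed
   coefficientwise.  When f has constant term 1, only the indices j <= n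
   contribute to the coefficient of t^n (see [fps_powE]). *)
Definition fps_pow (R : realType) (f : fps R) (a : R) : fps R :=
  fun n => limn (series (fun j =>
    fps_scale (gbinom a j) (fps_exp (fps_sub f (fps_one R)) j) n)).

(* E[e_lambda^Y(t)]; [fine] is harmless as soon as Y has all its moments. *)
Definition Edegexp (d : measure_display) (T : measurableType d) (R : realType)
    (P : probability T R) (Y : {RV P >-> R}) (lambda : R) : fps R :=
  egf_from 0 (fun n => fine 'E_P[fun w => degenerate_falling lambda (Y w) n]).

(* In the next two definitions the number is n! times the coefficient of t^n in
   the generating function on the left of its defining identity; the identities
   themselves are [prob_stirling2P] and [prob_bernsteinP]. *)
Definition prob_stirling2 (d : measure_display) (T : measurableType d)
    (R : realType) (P : probability T R) (Y : {RV P >-> R}) (lambda : R)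
    (n k : nat) : R :=
  n`!%:R *
  fps_scale (k`!%:R^-1) (fps_exp (fps_sub (Edegexp Y lambda) (fps_one R)) k) n.

Definition prob_bernstein (d : measure_display) (T : measurableType d)
    (R : realType) (P : probability T R) (Y : {RV P >-> R}) (lambda : R)
    (k n : nat) (x : R) : R :=
  n`!%:R *
  fps_scale (k`!%:R^-1 * degenerate_falling lambda x k)
    (fps_mul (fps_Xn R k) (fps_pow (Edegexp Y lambda) (1 - x))) n.

Section Facts.
Context (R : realType).

Lemma fps_exp_small (f : fps R) (k n : nat) :
  f 0%N = 0 -> (n < k)%N -> fps_exp f k n = 0.
Proof.
move=> f0; elim: k n => // k IHk n ltnk.
rewrite /fps_exp iterS /fps_mul big1// => -[[|i] /= ltin] _.
  by rewrite f0 mul0r.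
rewrite -/(fps_exp f k) IHk ?mulr0//.
by case: n ltnk ltin => // n ltnk _; rewrite subSS (leq_ltn_trans (leq_subr _ _)).
Qed.

Lemma fps_powE (f : fps R) (a : R) (n : nat) : f 0%N = 1 ->
  fps_pow f a n =
  \sum_(j < n.+1) gbinom a j * fps_exp (fps_sub f (fps_one R)) j n.
Proof.
move=> f0; apply: cvg_lim => //.
apply: (@cvg_trans _ (nbhs (cst (\sum_(j < n.+1) gbinom a j *
    fps_exp (fps_sub f (fps_one R)) j n) @ \oo))); last exact: cvg_cst.
apply: near_eq_cvg; exists n.+1 => // m /= ltnm.
rewrite /cst /series /= (@big_cat_nat _ _ _ n.+1)//= big_mkord.
rewrite [X in _ = _ + X]big_nat_cond [X in _ = _ + X]big1 ?addr0//.
move=> j; rewrite andbT => /andP[ltnj _].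
by rewrite /fps_scale fps_exp_small ?mulr0// /fps_sub f0 subrr.
Qed.

Context (d : measure_display) (T : measurableType d) (P : probability T R).
Context (Y : {RV P >-> R}) (lambda : R).

Lemma Edegexp0 : Edegexp Y lambda 0%N = 1.
Proof.
rewrite /Edegexp /egf_from /= divr1.
rewrite (_ : (fun w => _) = cst 1); first by rewrite expectation_cst.
by apply/funext => w; rewrite /degenerate_falling big_ord0.
Qed.

Lemma prob_stirling2P (k : nat) :
  fps_scale (k`!%:R^-1) (fps_exp (fps_sub (Edegexp Y lambda) (fps_one R)) k) =
  egf_from k (fun n => prob_stirling2 Y lambda n k).
Proof.
apply/funext => n; rewrite /egf_from; case: leqP => [_|ltnk].
  by rewrite /prob_stirling2 mulrAC divff ?mul1r// pnatr_eq0 -lt0n fact_gt0.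
by rewrite /fps_scale fps_exp_small ?mulr0// /fps_sub Edegexp0 subrr.
Qed.

Lemma prob_bernsteinP (k : nat) (x : R) :
  fps_scale (k`!%:R^-1 * degenerate_falling lambda x k)
    (fps_mul (fps_Xn R k) (fps_pow (Edegexp Y lambda) (1 - x))) =
  egf_from k (fun n => prob_bernstein Y lambda k n x).
Proof.
apply/funext => n; rewrite /egf_from; case: leqP => [_|ltnk].
  by rewrite /prob_bernstein mulrAC divff ?mul1r// pnatr_eq0 -lt0n fact_gt0.
rewrite /fps_scale /fps_mul big1 ?mulr0// => i _; rewrite /fps_Xn.
by rewrite ltn_eqF ?mul0r// (leq_trans _ ltnk)// ltn_ord.
Qed.

End Facts.

(* Main.v *)
Require Import Defs.
From HB Require Import structures.
From mathcomp Require Import all_boot all_order all_algebra.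
From mathcomp Require Import all_classical all_reals all_analysis.
From mathcomp Require Import ring.

Import Order.TTheory GRing.Theory Num.Theory.
Import numFieldNormedType.Exports.

Local Open Scope classical_set_scope.
Local Open Scope ring_scope.

(** Compare coefficients of $t^n$. The factor $t^k$ shifts the index to $n-k$ ([fps_mulXn]). As
    $E[e_\lambda^Y(t)]$ has constant term 1, the binomial series of its power $1-x$ stops at $j=n-k$
    ([fps_powE]), and its $j$-th term is a Stirling number up to factorials. *)

Lemma fps_mulXn (R : realType) (f : fps R) (k n : nat) : (k <= n)%N ->
  fps_mul (fps_Xn R k) f n = f (n - k)%N.
Proof.
move=> lekn; have ltkn : (k < n.+1)%N by [].
rewrite /fps_mul (bigD1 (Ordinal ltkn))//= /fps_Xn eqxx mul1r big1 ?addr0// => i.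
by rewrite -val_eqE /= => /negbTE ->; rewrite mul0r.
Qed.

Theorem theorem2p1 (R : realType) (d : measure_display) (T : measurableType d)
    (P : probability T R) (Y : {RV P >-> R}) (lambda x : R)
    (Ymgf : \forall t \near (0 : R), (mmt_gen_fun P Y t < +oo)%E)
    (x01 : 0 <= x <= 1) (n k : nat) (lekn : (k <= n)%N) :
  prob_bernstein Y lambda k n x =
  \sum_(0 <= j < (n - k).+1)
    'C(n, k)%:R * degenerate_falling lambda x k * gbinom (1 - x) j * j`!%:R *
    prob_stirling2 Y lambda (n - k) j.
Proof.
have fact_neq0 m : m`!%:R != 0 :> R by rewrite pnatr_eq0 -lt0n fact_gt0.
rewrite /prob_bernstein /fps_scale fps_mulXn// fps_powE ?Edegexp0//.
rewrite big_mkord !mulr_sumr; apply: eq_bigr => j _.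
rewrite /prob_stirling2 /fps_scale -(bin_fact lekn) !natrM.
by field; rewrite !fact_neq0.
Qed.
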